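(* Let $n>0$ and $\lambda,\mu\in P(n)$. Let $G(\lambda,\mu)$ be the set of partitions $\gamma$ that can be obtained both by removing a nonempty rim-hook from $\mathrm{dg}(\lambda)$ and by removing a nonempty rim-hook from $\mathrm{dg}(\mu)$. Then $$\sum_{\gamma\in G(\lambda,\mu)}n^{-1}\,\mathrm{sgn}(\lambda/\gamma)\,\mathrm{sgn}(\mu/\gamma)=\chi(\lambda=\mu).$$ Consequently, if $A_n$ is the $P(n)\times C(n)$ matrix with $A_n(\lambda,\beta)=\sum_{S\in\mathrm{RHT}(\lambda,\beta)}\mathrm{sgn}(S)$ and $B_n$ is the $C(n)\times P(n)$ matrix with $B_n(\beta,\mu)=\sum_{S\in\mathrm{RHT}(\mu,\beta)}Z_\beta^{-1}\mathrm{sgn}(S)$, then $A_nB_n=I_{P(n)}$ for all $n\ge 0$.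
   Context: $P(n)$ is the set of integer partitions of $n$, $C(n)$ the set of compositions of $n$. The diagram $\mathrm{dg}(\alpha)$ consists of left-justified rows of boxes, row $i$ from the top having $\alpha_i$ boxes. ''Obtained by removing $X$ from $\mathrm{dg}(\lambda)$'' means $\mathrm{dg}(\gamma)\subseteq\mathrm{dg}(\lambda)$ and $\lambda/\gamma:=\mathrm{dg}(\lambda)\setminus\mathrm{dg}(\gamma)=X$. A rim-hook of size $L$ is a set of $L$ boxes that can be traversed by starting at some box and successively moving one step right or one step up; its sign is $(-1)^{r-1}$ where $r$ is the number of rows it occupies. $\mathrm{RHT}(\lambda,\beta)$ is the set of fillings of $\mathrm{dg}(\lambda)$ such that for each $k$ the cells containing $k$ form a rim-hook of size $\beta_k$, and the cells containing $1,\dots,k$ form a partition diagram; the sign of such a filling is the product of the signs of its rim-hooks. For $\beta=(\beta_1,\dots,\beta_s)$, $Z_\beta=\beta_1(\beta_1+\beta_2)\cdots(\beta_1+\cdots+\beta_s)$ (and $Z_\emptyset=1$). $\chi(Q)$ is 1 if $Q$ holds, else 0. *)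

(* Defs.v *)
From HB Require Import structures.
From mathcomp Require Import all_boot all_order all_algebra finmap.

Set Implicit Arguments.
Unset Strict Implicit.
Unset Printing Implicit Defensive.

Import GRing.Theory.

Record composition (n : nat) := Composition {
  parts :> seq nat;
  _ : (0 \notin parts) && (sumn parts == n) }.

HB.instance Definition _ n := [isSub for @parts n].
HB.instance Definition _ n := [Countable of composition n by <:].

Definition comp_encode n (c : composition n) : n.-bseq 'I_n.+1 :=
  insub_bseq n (map inord c).

Definition comp_decode n (s : n.-bseq 'I_n.+1) : option (composition n) :=
  insub (map val s).

Lemma leq_size_sumn s : 0 \notin s -> size s <= sumn s.
Proof.
elim: s => //= x s IHs; rewrite inE negb_or eq_sym -lt0n => /andP[x_gt0 /IHs].
by rewrite -add1n; apply: leq_add.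
Qed.

Lemma mem_leq_sumn s i : i \in s -> i <= sumn s.
Proof.
elim: s => //= x s IHs; rewrite inE => /predU1P[->|/IHs i_le].
  exact: leq_addr.
exact: leq_trans i_le (leq_addl _ _).
Qed.

Lemma comp_encodeK n : pcancel (@comp_encode n) (@comp_decode n).
Proof.
move=> c; rewrite /comp_decode /comp_encode; case/andP: (valP c) => c0 /eqP cn.
have sz : size (map (@inord n) c) <= n.
  by rewrite size_map -{2}cn leq_size_sumn.
rewrite /insub_bseq insubdK // -map_comp (@eq_in_map _ _ _ id c).1 ?map_id ?valK //.
by move=> i ic /=; rewrite inordK // ltnS -cn; apply: mem_leq_sumn.
Qed.

HB.instance Definition _ n :=
  isFinite.Build (composition n) (pcan_enumP (@comp_encodeK n)).

Record intpart (n : nat) := IntPart {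
  comp_of_part :> composition n;
  _ : sorted geq comp_of_part }.

HB.instance Definition _ n := [isSub for @comp_of_part n].
HB.instance Definition _ n := [Finite of intpart n by <:].

(* The box (i, j) lies in row i and column j, both counted from 0, with row 0 *)
(* at the top.                                                                *)
Definition box := (nat * nat)%type.

Local Open Scope fset_scope.

Definition dg (a : seq nat) : {fset box} :=
  [fset ((i, j) : box) | i in iota 0 (size a), j in iota 0 (nth 0 a i)].

(* A partition with diagram X is necessarily a partition of #|X|.             *)
Definition is_partition_diagram (X : {fset box}) : bool :=
  [exists g : intpart #|` X|, X == dg g].

Definition step_right_or_up (c d : box) : bool :=
  (d == (c.1, c.2.+1)) || (c == (d.1.+1, d.2)).

(* The traversal t lists #|X| boxes and reaches all of X, hence visits each   *)
(* box once. The empty set is allowed here; it is excluded explicitly below   *)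
(* when removing a rim-hook, and by the positivity of the parts in RHT.       *)
Definition is_rim_hook (X : {fset box}) : bool :=
  [exists t : #|` X|.-tuple X,
     sorted step_right_or_up (map val t) && [forall c : X, c \in t]].

Definition removal_of_rim_hook (n m : nat) (lam : intpart n) (gam : intpart m)
    : bool :=
  [&& dg gam `<=` dg lam, dg lam `\` dg gam != fset0
    & is_rim_hook (dg lam `\` dg gam)].

Definition rows (X : {fset box}) : {fset nat} := [fset c.1 | c in X].

Definition sgn (X : {fset box}) : rat := ((-1) ^+ (#|` rows X|).-1)%R.

(* Since dg gam is contained in dg lam, gam is a partition of some k <= n, so *)
(* that the sigma type below contains every candidate gam.                    *)
Definition common_removals (n : nat) (lam mu : intpart n)
    : {set {k : 'I_n.+1 & intpart k}} :=
  [set g | removal_of_rim_hook lam (tagged g)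
         & removal_of_rim_hook mu (tagged g)].

(* The label k : 'I_(size b) stands for the entry k + 1, whose cells form a   *)
(* rim-hook of size nth 0 b k.                                                *)
Definition filling (a b : seq nat) := {ffun dg a -> 'I_(size b)}.

Definition cells_with (a b : seq nat) (S : filling a b) (P : pred 'I_(size b))
    : {fset box} :=
  [fsetval c in {: dg a} | P (S c)].

Definition RHT (a b : seq nat) : {set filling a b} :=
  [set S : filling a b | [forall k : 'I_(size b),
     [&& is_rim_hook (cells_with S (pred1 k)),
         #|` cells_with S (pred1 k)| == nth 0 b k
       & is_partition_diagram (cells_with S [pred l : 'I_(size b) | (l <= k)%N])]]].

Definition filling_sgn (a b : seq nat) (S : filling a b) : rat :=
  (\prod_(k < size b) sgn (cells_with S (pred1 k)))%R.

Definition Zcomp (b : seq nat) : nat :=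
  \prod_(k < size b) sumn (take k.+1 b).

Local Open Scope ring_scope.

Definition A_mx (n : nat) : 'M[rat]_(#|{: intpart n}|, #|{: composition n}|) :=
  \matrix_(i, j)
    (let lam : intpart n := enum_val i in let b : composition n := enum_val j in
     \sum_(S in RHT lam b) filling_sgn S).

Definition B_mx (n : nat) : 'M[rat]_(#|{: composition n}|, #|{: intpart n}|) :=
  \matrix_(i, j)
    (let b : composition n := enum_val i in let mu : intpart n := enum_val j in
     \sum_(S in RHT mu b) (Zcomp b)%:R^-1 * filling_sgn S).

(* Main.v *)
(* Encode a partition of n with parts lam_0 >= lam_1 >= ... by the set X of its *)
(* n beta-numbers lam_k + (n - k - 1). Removing a rim-hook from rows i, ..., j   *)
(* amounts to replacing an element x of X by some a < x outside X, and the       *)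
(* exponent j - i of the sign counts the elements of X strictly between a and x. *)
(* A common removal of lam and mu is therefore an equality X - x + a = Y - y + b. *)
(* For lam = mu it forces (x, a) = (y, b), and the number of pairs (x, a) is n.  *)
(* For lam <> mu the four numbers are distinct with x + b = y + a, and           *)
(* exchanging a with y (if y < x), or x with b (if x < y), is a sign-reversing   *)
(* involution. The matrix identity follows by induction on n, by peeling off     *)
(* the last part of the composition, hence the last rim-hook of both fillings.   *)

Require Import Defs.
From mathcomp Require Import all_boot all_order all_algebra finmap.
From mathcomp Require Import zify ring.

Set Implicit Arguments.
Unset Strict Implicit.
Unset Printing Implicit Defensive.

Import GRing.Theory Num.Theory.

Local Open Scope fset_scope.
Local Open Scope nat_scope.

(** * Traversals of rim-hooks *)

(** Beta-numbers turn the geometry of rim-hooks into arithmetic of finite sets. By [rim_hook_shape]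
    and [shape_rim_hook], removing a rim-hook from rows i, ..., j changes the row lengths so that
    the beta-numbers of rows i + 1, ..., j are only renumbered, that of row i disappears, and one
    new number a appears. Hence removals from [lam] correspond to pairs x in X, a not in X with a <
    x ([rim_shape_lower], [lower_rim_shape]), the sign being the parity of the number of elements of
    X jumped over.

    The first identity is then about pairs of lowerings of X and Y with the same result. If X = Y
    the two lowerings coincide ([lower_inj]), all signs square to 1, and [card_lowering] counts n of
    them. If X and Y differ, they differ exactly in x, b on one side and y, a on the other; as both
    sets have the same sum, x + b = y + a. Exchanging the two middle ones of these four numbers
    gives another such pair of lowerings, of opposite sign by [between_swap] ([lowering_offdiag]).

    For the matrices, [sum_RHT_rcons] peels off the last rim-hook. The last factor of [Zcomp] is n
    whatever the last part is, so it can be pulled out; induction forces the two remaining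
    partitions to be equal, and what is left is the first identity ([sum_RHT_orthogonal]). *)

Lemma in_dg (a : seq nat) i j : ((i, j) \in dg a) = (j < nth 0 a i).
Proof.
apply/idP/idP.
  case/imfset2P=> i' /= i'P [j' /= j'P] [-> ->].
  by move: j'P; rewrite mem_iota.
move=> lt_j; apply/imfset2P; exists i => /=; last exists j => //.
  by rewrite mem_iota /= add0n; case: ltnP => // /(nth_default 0) a0; rewrite a0 in lt_j.
by rewrite mem_iota.
Qed.

Lemma card_dg (a : seq nat) : #|` dg a| = sumn a.
Proof.
pose s := [seq ((i, j) : box) | i <- iota 0 (size a), j <- iota 0 (nth 0 a i)].
have us : uniq s.
  apply: allpairs_uniq_dep => [|i _|]; rewrite ?iota_uniq //.
  by case=> i j [i' j'] /= _ _ [-> ->].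
have sE : dg a =i s.
  case=> i j; rewrite in_dg; apply/idP/allpairsPdep => [lt_j|[i' [j' [_ /[swap] -[-> ->]]]]].
    exists i, j; rewrite !mem_iota /= add0n lt_j; split=> //.
    by case: ltnP => // /(nth_default 0) a0; rewrite a0 in lt_j.
  by rewrite mem_iota.
have /perm_size -> : perm_eq (enum_fset (dg a)) s.
  by apply: uniq_perm => // x; rewrite sE.
rewrite size_allpairs_dep; congr sumn; apply: (@eq_from_nth _ 0).
  by rewrite size_map size_iota.
move=> i; rewrite size_map size_iota => lt_i.
by rewrite (nth_map 0) ?size_iota //= nth_iota // size_iota.
Qed.

(* A step right or up raises the content (column minus row) by one, so distinct *)
(* boxes of a rim-hook have distinct contents.                                 *)
Lemma traversal_content (s : seq box) c d : sorted step_right_or_up s ->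
  c \in s -> d \in s -> (c.2 + d.1 = d.2 + c.1)%N -> c = d.
Proof.
move=> s_step cs ds; pose r := [rel c d : box | (c.2 + d.1 < d.2 + c.1)%N].
have r_tr : transitive r by move=> x y z /=; lia.
have s_r : sorted r s.
  apply: sub_sorted s_step => -[i j] [i' j'] /orP[/eqP[-> ->]|/eqP[-> ->]] /=; lia.
have lt_nth := sorted_ltn_nth r_tr c s_r.
move=> Ecd; rewrite -(nth_index c cs) -(nth_index c ds).
have [lt|lt|->] // := ltngtP (index c s) (index d s).
  have := lt_nth _ _ _ _ lt; rewrite !inE !index_mem !nth_index // => /(_ cs ds).
  by rewrite /= Ecd ltnn.
have := lt_nth _ _ _ _ lt; rewrite !inE !index_mem !nth_index // => /(_ ds cs).
by rewrite /= Ecd ltnn.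
Qed.

Lemma traversal_uniq (s : seq box) : sorted step_right_or_up s -> uniq s.
Proof.
pose r := [rel c d : box | (c.2 + d.1 < d.2 + c.1)%N].
move=> s_step; apply: (@sorted_uniq _ r); first by move=> x y z /=; lia.
  by move=> x /=; lia.
apply: sub_sorted s_step => -[i j] [i' j'] /orP[/eqP[-> ->]|/eqP[-> ->]] /=; lia.
Qed.

Lemma is_rim_hookP (X : {fset box}) :
  reflect (exists2 s : seq box, sorted step_right_or_up s & s =i X)
          (is_rim_hook X).
Proof.
apply: (iffP existsP) => [[t /andP[st /forallP tX]]|[s st sX]].
  exists (map val t) => // c; apply/mapP/idP => [[x _ ->]|cX]; first exact: valP.
  by exists [` cX] => //; apply: tX.
(* The length is right because a traversal never repeats a box. *)
have sz : size (pmap insub s : seq X) == #|` X|.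
  rewrite size_pmap_sub (eq_in_count (a2 := predT)) ?count_predT; last first.
    by move=> c; rewrite sX.
  apply/eqP/perm_size/uniq_perm => //; exact: traversal_uniq.
exists (Tuple sz) => /=; apply/andP; split.
  rewrite (pmap_filter (@insubK _ _ _)) (eq_in_filter (a2 := predT)) ?filter_predT //.
  by move=> c; rewrite sX => cX; rewrite insubT.
apply/forallP => c; rewrite -(mem_map val_inj).
rewrite (pmap_filter (@insubK _ _ _)) mem_filter sX (valP c) andbT.
by rewrite valK.
Qed.

(** Row-length form of a rim-hook in rows i to j: the equation says that the last box of row k + 1
    lies directly below the first removed box of row k, which is where the traversal steps up. *)
Definition rim_shape (f g : nat -> nat) (i j : nat) : Prop :=
  [/\ i <= j, forall k, (k < i) || (j < k) -> g k = f k,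
      forall k, i <= k < j -> (g k).+1 = f k.+1 & g j < f j].

Lemma rim_shape_lt f g i j k : (forall k, f k.+1 <= f k) ->
  rim_shape f g i j -> i <= k <= j -> g k < f k.
Proof.
move=> f_dec [_ _ gS gj] /andP[ik]; rewrite leq_eqVlt => /predU1P[->//|kj].
by rewrite gS ?f_dec // ik kj.
Qed.

Lemma row_traversal k a l :
  path step_right_or_up (k, a) [seq (k, c) | c <- iota a.+1 l] /\
  last (k, a) [seq (k, c) | c <- iota a.+1 l] = (k, (a + l)%N).
Proof.
elim: l a => [|l IHl] a /=; first by rewrite addn0.
by rewrite /step_right_or_up /= eqxx !(IHl a.+1).1 (IHl a.+1).2 addSnnS.
Qed.

(** Induction on the number of rows, adding the top row last: the traversal of the lower rows ends
    at the last box of row i + 1, directly below the box (i, g i) where row i is entered. The clause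
    on the last box serves this induction. *)
Lemma shape_traversal (f g : nat -> nat) i d :
    (forall k, i <= k <= (i + d)%N -> g k < f k) ->
    (forall k, i <= k < (i + d)%N -> (g k).+1 = f k.+1) ->
  exists x s, [/\ path step_right_or_up x s, last x s = (i, (f i).-1) &
    forall k c, ((k, c) \in x :: s) = (i <= k <= (i + d)%N) && (g k <= c < f k)].
Proof.
have mem_row k k' a l c : ((k', c) \in (k, a) :: [seq (k, c) | c <- iota a.+1 l])
     = (k == k') && (a <= c <= (a + l)%N).
  rewrite inE xpair_eqE; apply/idP/idP => [/orP[/andP[/eqP-> /eqP->]|/mapP[c' + [-> ->]]]|].
  - by rewrite eqxx leqnn leq_addr.
  - by rewrite eqxx mem_iota; lia.
  case/andP => /eqP-> lec; rewrite eqxx /=; case: eqP => //= nca.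
  by apply: map_f; rewrite mem_iota; lia.
elim: d i => [|d IHd] i g_lt gS.
  have gi : g i < f i by apply: g_lt; lia.
  have [row_path row_last] := row_traversal i (g i) (f i - (g i).+1).
  exists (i, g i); exists [seq (i, c) | c <- iota (g i).+1 (f i - (g i).+1)].
  split=> // [|k c]; first by rewrite row_last; congr pair; lia.
  by rewrite mem_row; case: (eqVneq i k) => [<-|]; lia.
have gi : g i < f i by apply: g_lt; lia.
have [row_path row_last] := row_traversal i (g i) (f i - (g i).+1).
have [||x [s [s_path s_last s_mem]]] := IHd i.+1.
- by move=> k k_in; apply: g_lt; lia.
- by move=> k k_in; apply: gS; lia.
exists x; exists (s ++ (i, g i) :: [seq (i, c) | c <- iota (g i).+1 (f i - (g i).+1)]).
split.
- rewrite cat_path s_path /= row_path s_last andbT /step_right_or_up /=.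
  by rewrite -(gS i) ?eqxx ?orbT //; lia.
- by rewrite last_cat /= row_last; congr pair; lia.
move=> k c; rewrite -cat_cons mem_cat s_mem mem_row.
by case: (eqVneq i k) => [<-|]; lia.
Qed.

Lemma shape_rim_hook (D : {fset box}) f g i j : (forall k, f k.+1 <= f k) ->
    (forall k c, ((k, c) \in D) = (g k <= c < f k)) -> rim_shape f g i j ->
  [/\ is_rim_hook D, D != fset0 & #|` rows D| = (j - i).+1].
Proof.
move=> f_dec memD fg; have g_lt := rim_shape_lt f_dec fg.
case: fg => [le_ij gE gS gj].
have [||x [s [s_path _ s_mem]]] := @shape_traversal f g i (j - i).
- by move=> k k_in; apply: g_lt; lia.
- by move=> k k_in; apply: gS; lia.
split.
- apply/is_rim_hookP; exists (x :: s) => // -[k c]; rewrite s_mem memD subnKC //.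
  case: (boolP (i <= k <= j)) => //= k_out.
  by rewrite gE; lia.
- by apply/fset0Pn; exists (j, g j); rewrite memD leqnn.
have rowsE : rows D =i iota i (j - i).+1.
  move=> k; rewrite mem_iota; apply/imfsetP/idP => [[[k' c] /= + ->]|k_in].
    rewrite memD /=; case: (boolP (i <= k' <= j)) => [|k_out]; first by lia.
    by rewrite gE; lia.
  exists (k, g k) => //=; rewrite memD leqnn g_lt //; lia.
rewrite -(size_iota i (j - i).+1); apply/perm_size/uniq_perm => //.
exact: iota_uniq.
Qed.

(** Rows decrease by at most one at each step, and a step that changes the row keeps the column. *)
Lemma traversal_crosses (x : box) s k : path step_right_or_up x s ->
  (last x s).1 <= k -> k < x.1 ->
  exists c, (k.+1, c) \in x :: s /\ (k, c) \in x :: s.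
Proof.
elim: s x => [|y s IHs] x /= => [_|/andP[xy ys] lt_l lt_x]; first lia.
have [lt_y|le_y] := ltnP k y.1.
  by have [c [c1 c2]] := IHs y ys lt_l lt_y; exists c; rewrite inE c1 orbT inE c2 orbT.
move: xy lt_x le_y; rewrite /step_right_or_up; case: x y {IHs ys lt_l} => [x1 x2] [y1 y2] /=.
case/orP=> /eqP[-> ->] /= lt_x le_y; first lia.
have -> : k = y1 by lia.
by exists y2; rewrite !inE !eqxx orbT.
Qed.

Lemma traversal_rows (x c : box) s : path step_right_or_up x s ->
  c \in x :: s -> (last x s).1 <= c.1 <= x.1.
Proof.
elim: s x c => [|y s IHs] x c /= => [_|/andP[xy ys]].
  by rewrite inE => /eqP->; rewrite leqnn.
have le_yx : y.1 <= x.1.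
  move: xy; rewrite /step_right_or_up; case: x y {IHs ys} => [x1 x2] [y1 y2] /=.
  by case/orP=> /eqP[-> _]; lia.
have := IHs _ y ys (mem_head _ _); rewrite inE => y_in /predU1P[->|/(IHs _ _ ys)]; lia.
Qed.

(** The traversal starts in the bottom row j and ends in the top row i. A crossing from row k + 1 to
    row k gives these rows a common column, so g k < f (k + 1); a larger overlap would put two boxes
    of equal content into the hook. *)
Lemma rim_hook_shape (D : {fset box}) f g :
    (forall k, f k.+1 <= f k) -> (forall k, g k.+1 <= g k) ->
    (forall k, g k <= f k) ->
    (forall k c, ((k, c) \in D) = (g k <= c < f k)) ->
  D != fset0 -> is_rim_hook D -> exists i j, rim_shape f g i j.
Proof.
move=> f_dec g_dec le_gf memD /fset0Pn[b bD] /is_rim_hookP[s s_step sD].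
case: s => [|x s] in s_step sD; first by rewrite -sD in bD.
exists (last x s).1, x.1.
have xs_rows := traversal_rows s_step.
have g_lt k c : (k, c) \in D -> g k < f k by rewrite memD; lia.
split=> [|k k_out|k k_in|].
- by have := xs_rows x (mem_head _ _); lia.
- apply/eqP; rewrite eqn_leq le_gf leqNgt; apply/negP => lt_gf.
  have := xs_rows (k, g k); rewrite sD memD leqnn lt_gf /=; lia.
- have [||c [c1 c2]] := traversal_crosses (k := k) s_step; try lia.
  apply/eqP; rewrite eqn_leq; apply/andP; split.
    by rewrite sD memD in c1; rewrite sD memD in c2; lia.
  rewrite leqNgt; apply/negP => lt_f.
  have := f_dec k; have := g_dec k => leg lef.
  (* These two boxes are diagonal neighbours, the bottom right and top left corners of a 2 by 2
     square. *)
  have d1 : (k.+1, (f k.+1).-1) \in x :: s by rewrite sD memD; lia.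
  have d2 : (k, (f k.+1).-2) \in x :: s by rewrite sD memD; lia.
  suff [] : (k.+1, (f k.+1).-1) = (k, (f k.+1).-2) :> box by lia.
  by apply: (traversal_content s_step d1 d2) => /=; lia.
- by case: x s_step sD xs_rows => x1 x2 _ sD _; apply: (g_lt x1 x2); rewrite -sD mem_head.
Qed.

(** * Beta-numbers *)

Lemma nth_intpart_dec n (lam : intpart n) k : nth 0 lam k.+1 <= nth 0 lam k.
Proof.
have [lt_k|le_k] := ltnP k.+1 (size lam); last by rewrite nth_default.
by have /(sortedP 0) := valP lam; apply.
Qed.

Lemma in_dgD (a b : seq nat) k c :
  ((k, c) \in dg a `\` dg b) = (nth 0 b k <= c < nth 0 a k).
Proof. by rewrite in_fsetD !in_dg -leqNgt. Qed.

Lemma removal_of_rim_hookP n m (lam : intpart n) (gam : intpart m) :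
  reflect (exists i j, rim_shape (nth 0 lam) (nth 0 gam) i j)
          (removal_of_rim_hook lam gam).
Proof.
have lam_dec := nth_intpart_dec lam.
apply: (iffP and3P) => [[/fsubsetP sub D0 hook]|[i [j fg]]].
  apply: rim_hook_shape (in_dgD lam gam) D0 hook => // k; first exact: nth_intpart_dec.
  rewrite leqNgt; apply/negP => lt_k.
  by have := sub (k, nth 0 lam k); rewrite !in_dg lt_k ltnn => /(_ isT).
have [hook D0 _] := shape_rim_hook lam_dec (in_dgD lam gam) fg.
split=> //; apply/fsubsetP => -[k c]; rewrite !in_dg => /leq_trans; apply.
have [/(rim_shape_lt lam_dec fg)/ltnW //|k_out] := boolP (i <= k <= j).
by case: fg => _ gE _ _; rewrite gE //; lia.
Qed.

Lemma sgn_rim_shape n m (lam : intpart n) (gam : intpart m) i j :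
  rim_shape (nth 0 lam) (nth 0 gam) i j ->
  sgn (dg lam `\` dg gam) = ((-1) ^+ (j - i)%N)%R.
Proof.
move=> /(shape_rim_hook (nth_intpart_dec lam) (in_dgD lam gam))[_ _].
by rewrite /sgn => ->.
Qed.

(* [N] rows are considered; [N] must be at least the number of parts. *)
Definition beta (N : nat) (f : nat -> nat) k := f k + (N - k.+1).

Lemma dec_leq (f : nat -> nat) k l :
  (forall k, f k.+1 <= f k) -> k <= l -> f l <= f k.
Proof.
move=> f_dec /subnK <-; elim: (l - k) => //= d IHd.
exact: leq_trans (f_dec _) IHd.
Qed.

Lemma beta_lt N f k l : (forall k, f k.+1 <= f k) ->
  k < l < N -> beta N f l < beta N f k.
Proof.
by move=> f_dec kl; have := @dec_leq f k l f_dec; rewrite /beta; lia.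
Qed.

Definition beta_set (N M : nat) (f : nat -> nat) : {set 'I_M} :=
  [set x : 'I_M | [exists k : 'I_N, val x == beta N f k]].

Lemma in_beta_set N M f (x : 'I_M) :
  reflect (exists2 k, k < N & val x = beta N f k) (x \in beta_set N M f).
Proof.
rewrite inE; apply: (iffP existsP) => [[k /eqP xk]|[k lt_k xk]]; first by exists k.
by exists (Ordinal lt_k); rewrite xk.
Qed.

Definition lowering (M : nat) (X : {set 'I_M}) (p : 'I_M * 'I_M) :=
  [&& p.1 \in X, p.2 \notin X & p.2 < p.1].

Definition lower (M : nat) (X : {set 'I_M}) (p : 'I_M * 'I_M) : {set 'I_M} :=
  p.2 |: X :\ p.1.

Definition lower_sgn (M : nat) (X : {set 'I_M}) (p : 'I_M * 'I_M) : rat :=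
  ((-1) ^+ #|[set z in X | (p.2 < z < p.1)%N]|)%R.

Section Beta.

Variables (N M : nat) (f : nat -> nat).
Hypothesis f_dec : forall k, f k.+1 <= f k.
Hypothesis f_M : f 0 + N <= M.

Lemma beta_ltM k : k < N -> beta N f k < M.
Proof. by have := @dec_leq f 0 k f_dec; rewrite /beta; lia. Qed.

(** For i <= k < j the beta-number of g at k is that of f at k + 1, so the two sets differ only by x
    = [beta N f i] leaving and a = [beta N g j] entering. *)
Lemma rim_shape_lower g i j (x a : 'I_M) : (forall k, g k.+1 <= g k) ->
    rim_shape f g i j -> j < N -> val x = beta N f i -> val a = beta N g j ->
  [/\ lowering (beta_set N M f) (x, a),
      beta_set N M g = lower (beta_set N M f) (x, a) &
      lower_sgn (beta_set N M f) (x, a) = ((-1) ^+ (j - i)%N)%R].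
Proof.
move=> g_dec [le_ij gE gS gj] lt_j xE aE.
have f_lt k l : k < l < N -> beta N f l < beta N f k by apply: beta_lt.
have g_lt k l : k < l < N -> beta N g l < beta N g k by apply: beta_lt.
have gE' k : (k < i) || (j < k) -> beta N g k = beta N f k.
  by rewrite /beta => /gE->.
have gS' k : i <= k < j -> beta N g k = beta N f k.+1.
  by move=> k_in; have := gS k k_in; rewrite /beta; lia.
have gj' : beta N g j < beta N f j by rewrite /beta; lia.
(* In the decreasing list of beta-numbers of f, the new number a falls just after position j. *)
have lt_af k : k < N -> (a < beta N f k) = (k <= j).
  move=> lt_k; rewrite aE; have [le_kj|lt_jk] := leqP k j.
    by case: ltngtP le_kj (f_lt k j) => // [|->]; lia.
  by rewrite -gE' ?lt_jk ?orbT //; have := g_lt j k; lia.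
have lt_fx k : k < N -> (beta N f k < x) = (i < k).
  move=> lt_k; rewrite xE; case: (ltngtP i k) => [lt|lt|->]; last exact: ltnn.
    by have := f_lt i k; lia.
  by have := f_lt k i; lia.
split.
- apply/and3P; split; first by apply/in_beta_set; exists i => //; lia.
    apply/in_beta_set => -[k lt_k ak]; have := lt_af k lt_k; rewrite ak ltnn.
    rewrite aE in ak; have := f_lt j k; have := lt_af k lt_k; rewrite aE -ak ltnn.
    have := gE' k; have := g_lt j k; lia.
  by rewrite /= xE lt_af; lia.
- apply/setP => z; rewrite !inE; apply/existsP/idP => [[k /eqP zk]|].
    have lt_k := ltn_ord k.
    have [kj|neq_kj] := eqVneq (k : nat) j.
      by apply/orP; left; apply/eqP/val_inj; rewrite zk kj.
    have [k_in|k_out] := boolP (i <= k < j).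
      apply/orP; right; apply/andP; split.
        apply/eqP => /(congr1 val); rewrite zk xE gS' // => e.
        by have := f_lt i k.+1; rewrite e ltnn; lia.
      have lt_k1 : k.+1 < N by lia.
      by apply/existsP; exists (Ordinal lt_k1); rewrite zk gS'.
    have k_out' : (k < i) || (j < k) by lia.
    apply/orP; right; apply/andP; split; last by apply/existsP; exists k; rewrite zk gE'.
    apply/eqP => /(congr1 val); rewrite zk xE gE' // => e.
    by have := f_lt i k; have := f_lt k i; rewrite e ltnn; lia.
  case/orP=> [/eqP->|/andP[zx /existsP[k /eqP zk]]].
    by exists (Ordinal lt_j); rewrite aE.
  have ki : (k : nat) != i by apply: contra zx => /eqP ki; apply/eqP/val_inj; rewrite zk xE ki.
  have lt_k := ltn_ord k.
  have [k_in|k_out] := boolP (i < k <= j).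
    have lt_k1 : k.-1 < N by lia.
    by exists (Ordinal lt_k1); rewrite zk gS' ?prednK //=; lia.
  by exists k; rewrite zk gE' //; lia.
congr (_ ^+ _)%R.
(* The elements of X strictly between a and x are the beta-numbers of rows i + 1, ..., j. The
   default x is never taken, all these numbers being below M. *)
pose h (k : 'I_(j - i)) := insubd x (beta N f (i + k).+1).
have hE k : val (h k) = beta N f (i + k).+1.
  by rewrite insubdK //; apply: beta_ltM; have := ltn_ord k; lia.
have h_inj : injective h.
  move=> k l /(congr1 val); rewrite !hE => e; apply: val_inj => /=.
  have := f_lt (i + k).+1 (i + l).+1; have := f_lt (i + l).+1 (i + k).+1.
  by rewrite e ltnn; have := ltn_ord k; have := ltn_ord l; lia.
rewrite -[RHS]card_ord -(card_imset _ h_inj); apply: eq_card => z.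
rewrite inE; apply/andP/imsetP => [[/in_beta_set[k lt_k zk]]|[k _ ->]].
  rewrite /= zk lt_af // lt_fx // => k_in.
  have lt_k' : k - i.+1 < j - i by lia.
  exists (Ordinal lt_k') => //; apply: val_inj; rewrite hE zk /=; congr beta; lia.
have lt_k := ltn_ord k; rewrite /= hE; split.
  by apply/in_beta_set; exists (i + k).+1; rewrite ?hE //; lia.
rewrite lt_af ?lt_fx; lia.
Qed.

Hypothesis f_N : forall k, N <= k -> f k = 0.

Lemma lower_rim_shape (x a : 'I_M) : lowering (beta_set N M f) (x, a) ->
  exists g i j, [/\ forall k, g k.+1 <= g k, forall k, N <= k -> g k = 0,
    rim_shape f g i j, j < N & val x = beta N f i /\ val a = beta N g j].
Proof.
clear f_M; case/and3P=> /= /in_beta_set[i lt_i xi] /in_beta_set a_out lt_ax.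
(* The bottom row j of the hook is the last row whose beta-number exceeds a. *)
have ex_j : exists j, (j < N) && (a < beta N f j) by exists i; rewrite lt_i -xi.
have j_le j : (j < N) && (a < beta N f j) -> j <= N by case/andP=> /ltnW.
case: (ex_maxnP ex_j j_le) => j /andP[lt_j lt_a] j_max.
have le_ij : i <= j by apply: j_max; rewrite lt_i -xi.
have lt_a1 : j.+1 < N -> beta N f j.+1 < a.
  move=> lt_j1; rewrite ltn_neqAle; apply/andP; split.
    by apply/eqP => e; apply: a_out; exists j.+1.
  by rewrite leqNgt; apply/negP => lt; have := j_max j.+1; rewrite lt_j1 lt ltnn => /(_ isT).
have a_ge : N - j.+1 <= a by move: lt_a1; rewrite /beta; lia.
have fj_gt0 : 0 < f j by move: lt_a; rewrite /beta; lia.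
have f_gt0 k : k <= j -> 0 < f k by move/(dec_leq f_dec); lia.
(* The value at j is chosen to make [beta N g j] equal to a; the truncated subtraction is exact by
   [a_ge]. *)
pose g k := if i <= k < j then (f k.+1).-1 else if k == j then a - (N - j.+1) else f k.
exists g, i, j; split=> // [k|k le_k||].
- have f1 := f_dec k; have f2 := f_dec k.+1; have := f_gt0 k.+1; have := @f_N k.+1.
  rewrite /g; move: lt_a lt_a1; rewrite /beta => lt_a lt_a1 fN f0.
  have ek : k = j -> f k = f j /\ f k.+1 = f j.+1 by move->.
  have ek1 : k.+1 = j -> f k.+1 = f j by move->.
  by do ?[case: ifP => ?]; lia.
- by have := f_N le_k; rewrite /g; do ?[case: ifP => ?]; lia.
- split=> //.
  + by move=> k k_out; rewrite /g; do ?[case: ifP => ?]; lia.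
  + by move=> k k_in; rewrite /g k_in prednK // f_gt0; lia.
  by rewrite /g ltnn andbF eqxx; move: lt_a; rewrite /beta; lia.
by split=> //; rewrite /beta /g ltnn andbF eqxx; lia.
Qed.

(** The beta-number of f in row k is that of g in some row l. The rows l < k are excluded, since
    there f and g agree and have larger beta-numbers; hence l >= k and monotonicity concludes. *)
Lemma beta_set_le g k : (forall k, g k.+1 <= g k) ->
    (forall l, l < k -> f l = g l) -> beta_set N M f = beta_set N M g ->
  k < N -> f k <= g k.
Proof.
move=> g_dec fg_lt fg lt_k; have lt_M := beta_ltM lt_k.
have : Ordinal lt_M \in beta_set N M f by apply/in_beta_set; exists k.
rewrite fg => /in_beta_set[l lt_l /= fk_gl].
have le_kl : k <= l.
  rewrite leqNgt; apply/negP => lt_lk; have := @beta_lt N f l k f_dec.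
  by rewrite fk_gl /beta fg_lt // ltnn; lia.
by have := dec_leq g_dec le_kl; move: fk_gl; rewrite /beta; lia.
Qed.

End Beta.

Lemma beta_set_inj N M f g k :
    (forall k, f k.+1 <= f k) -> (forall k, g k.+1 <= g k) ->
    f 0 + N <= M -> g 0 + N <= M -> beta_set N M f = beta_set N M g ->
  k < N -> f k = g k.
Proof.
move=> f_dec g_dec fM gM fg; elim/ltn_ind: k => k IHk lt_k.
have IH l : l < k -> f l = g l by move=> lt_l; apply: IHk (ltn_trans lt_l lt_k).
apply/eqP; rewrite eqn_leq; apply/andP; split.
  exact: (beta_set_le f_dec fM g_dec IH fg).
by apply: (beta_set_le g_dec gM f_dec _ (esym fg)) => // l /IH.
Qed.

(** * The sign-reversing involution *)

Section Lowering.

Variable M : nat.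
Implicit Types (X Y : {set 'I_M}) (p q : 'I_M * 'I_M).

(** The pair can be read off the result: a is its only element outside X, and x the only element of
    X that it lacks. *)
Lemma lower_inj X p q : lowering X p -> lowering X q ->
  lower X p = lower X q -> p = q.
Proof.
case: p q => [x a] [y b] /and3P[/= xX aX lt_ax] /and3P[/= yX bX lt_by] /setP E.
have ab : a = b.
  by apply/eqP; have := E a; rewrite !inE eqxx /= (negPf aX) andbF orbF => <-.
congr pair => //; apply/eqP; have := E x.
rewrite !inE eqxx /= xX andbT orbF -ab.
have -> /= : (x == a) = false by apply/negP => /eqP xa; rewrite -xa xX in aX.
by case: eqP.
Qed.

Lemma sum_lower X p : lowering X p ->
  \sum_(z in lower X p) z + p.1 = \sum_(z in X) z + p.2.
Proof.
case: p => x a /and3P[/= xX aX _].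
rewrite big_setU1 /=; last by rewrite !inE (negPf aX) andbF.
by rewrite (big_setD1 x xX) /= addnC addnA addnAC.
Qed.

Lemma lowering_diag X : (\sum_(p | lowering X p)
    \sum_(q | lowering X q && (lower X p == lower X q))
      lower_sgn X p * lower_sgn X q
  = #|[set p | lowering X p]|%:R)%R.
Proof.
rewrite -sum1_card natr_sum /= [RHS](eq_bigl (lowering X)); last by move=> p; rewrite inE.
apply: eq_bigr => p pX; rewrite (big_pred1 p) => [|q]; first by rewrite -expr2 sqrr_sign.
apply/andP/eqP => [[qX /eqP/(lower_inj pX qX)]//|->].
by rewrite pX eqxx.
Qed.

Definition between X (a x : nat) := #|[set z in X | (a < z < x)%N]|.

Lemma between_split X (a x : nat) (y : 'I_M) : a < y < x ->
  between X a x = between X a y + (y \in X) + between X y x.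
Proof.
move=> y_in; rewrite /between.
rewrite (cardsD1 y) inE y_in andbT addnAC addnC; congr (_ + _).
rewrite -cardsUI [X in _ + X](_ : _ = 0); last first.
  by apply: eq_card0 => z; rewrite !inE; lia.
rewrite addn0; apply: eq_card => z; rewrite !inE -val_eqE /=.
by case: (z \in X); rewrite ?andbF //=; lia.
Qed.

(** Splitting at v and at u, the elements between u and v are counted once in X and once in Y and
    cancel modulo 2; what remains is the single element u of Y. *)
Lemma between_swap X Y (l r : nat) (u v : 'I_M) : l < u -> u < v -> v < r ->
    u \in Y -> v \notin X ->
    (forall z : 'I_M, u < z < v -> (z \in X) = (z \in Y)) ->
  ((-1) ^+ between X u r * (-1) ^+ between Y l v
    = - ((-1) ^+ between X v r * (-1) ^+ between Y l u) :> rat)%R.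
Proof.
move=> lt_lu lt_uv lt_vr uY vX XY.
rewrite (@between_split X u r v) ?lt_uv // (negPf vX) addn0.
rewrite (@between_split Y l v u) ?lt_lu // uY.
have -> : between X u v = between Y u v.
  by apply: eq_card => z; rewrite !inE; case: (boolP (u < z < v)) => [/XY->|]; rewrite ?andbF.
rewrite -!exprD -[LHS]signr_odd -[in RHS]signr_odd -signrN !oddD /=.
by congr ((-1) ^+ nat_of_bool _)%R; do 3!case: (odd _).
Qed.

Lemma lowering_offdiag X Y :
    X != Y -> \sum_(z in X) z = \sum_(z in Y) z ->
  (\sum_(p | lowering X p) \sum_(q | lowering Y q && (lower X p == lower Y q))
     lower_sgn X p * lower_sgn Y q = 0 :> rat)%R.
Proof.
move=> neqXY sumXY; rewrite pair_big_dep /=.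
pose P t := [&& lowering X t.1, lowering Y t.2 & lower X t.1 == lower Y t.2].
(* With t = ((x, a), (y, b)), the result is ((x, y), (a, b)) if y < x and ((b, a), (y, x))
   otherwise. *)
pose h (t : ('I_M * 'I_M) * ('I_M * 'I_M)) :=
  if t.2.1 < t.1.1 then ((t.1.1, t.2.1), (t.1.2, t.2.2))
  else ((t.2.2, t.1.2), (t.2.1, t.1.1)).
have Pt x a y b : P ((x, a), (y, b)) ->
  [/\ [/\ x \in X, x \notin Y, a \notin X & a \in Y],
      [/\ y \notin X, y \in Y, b \in X & b \notin Y],
      [/\ a < x, b < y & x + b = y + a],
      [/\ x != y, a != b, x != b & y != a] &
      forall z, z != x -> z != a -> z != y -> z != b -> (z \in X) = (z \in Y)].
  case/and3P => /= xX_ yY_ /eqP eXY; have := sum_lower yY_; have := sum_lower xX_.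
  rewrite eXY -sumXY /= => s1 s2.
  case/and3P: xX_ => /= xX aX lt_ax; case/and3P: yY_ => /= yY bY lt_by.
  have xbya : x + b = y + a by lia.
  have E z : (z == a) || (z != x) && (z \in X) = (z == b) || (z != y) && (z \in Y).
    by have /setP/(_ z) := eXY; rewrite !inE.
  have xa : x != a by apply: contraNneq aX => <-.
  have yb : y != b by apply: contraNneq bY => <-.
  have ab : a != b.
    apply: contraNneq neqXY => ab; have xy : x = y.
      by apply: val_inj; apply: (@addIn b); rewrite xbya ab.
    apply/eqP/setP => z; have := E z; rewrite -ab -xy.
    have [->|_] := eqVneq z a; first by rewrite (negPf aX) ab (negPf bY).
    by have [->|_] := eqVneq z x; [rewrite xX xy yY|].
  have xy : x != y.
    apply: contraNneq ab => xy; apply/eqP/val_inj/(@addnI x).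
    by rewrite /= xbya xy.
  have := E a; rewrite eqxx (negPf ab) /= => /esym/andP[ay aY].
  have := E b; rewrite eqxx [b == a]eq_sym (negPf ab) /= => /andP[bx bX].
  have := E x; rewrite eqxx (negPf xa) [x == b]eq_sym (negPf bx) xy /= => /esym/negbT xY.
  have := E y; rewrite eqxx [y == a]eq_sym (negPf ay) (negPf yb) /=.
  rewrite eq_sym xy /= => /negbT yX.
  split=> //.
  by move=> z zx za zy zb; have := E z; rewrite (negPf za) (negPf zb) zx zy.
(* Since x + b = y + a, the inequality y < x goes with b < a, and x < y with a < b, so the new pairs
   are again lowerings. The test in [h] has the same outcome on [h t], whence the involution. *)
have PhK t : P t -> P (h t) /\ h (h t) = t.
  case: t => [[x a] [y b]] /Pt[[xX xY aX aY] [yX yY bX bY] [lt_ax lt_by xbya]].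
  move=> [xy ab xb ya] E; rewrite /P /h /lowering /=.
  have xa : x != a by apply: contraNneq aX => <-.
  have yb : y != b by apply: contraNneq bY => <-.
  have neq_xy : (x : nat) != y by [].
  have [lt_ba lt_xy le_by lt_ab] : [/\ y < x -> b < a, x <= y -> x < y,
      x <= y -> y < b = false & x <= y -> a < b].
    by move: lt_ax lt_by xbya neq_xy; clear; split; lia.
  have nE := (negPf xy, negPf ab, negPf xb, negPf ya, negPf xa, negPf yb).
  have nE' : ((y == x) = false) * ((b == a) = false) * ((b == x) = false)
     * ((a == y) = false) * ((a == x) = false) * ((b == y) = false).
    by do 5?split; rewrite eq_sym nE.
  have mE := (negPf xY, negPf aX, negPf yX, negPf bY, xX, aY, yY, bX).
  have [lt_yx|le_xy] := ltnP y x; rewrite /= !mE /=.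
    split; last by rewrite lt_ax.
    apply/and3P; split; [exact: lt_yx | exact: lt_ba |].
    apply/eqP/setP => z; rewrite !inE /=.
    have [->|zx] := eqVneq z x; first by rewrite ?(eqxx, nE, nE', mE).
    have [->|za] := eqVneq z a; first by rewrite ?(eqxx, nE, nE', mE).
    have [->|zy] := eqVneq z y; first by rewrite ?(eqxx, nE, nE', mE).
    have [->|zb] := eqVneq z b; first by rewrite ?(eqxx, nE, nE', mE).
    by rewrite E.
  split; last by rewrite (le_by le_xy).
  apply/and3P; split; [exact: lt_ab | exact: lt_xy |].
  apply/eqP/setP => z; rewrite !inE /=.
  have [->|zx] := eqVneq z x; first by rewrite ?(eqxx, nE, nE', mE).
  have [->|za] := eqVneq z a; first by rewrite ?(eqxx, nE, nE', mE).
  have [->|zy] := eqVneq z y; first by rewrite ?(eqxx, nE, nE', mE).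
  have [->|zb] := eqVneq z b; first by rewrite ?(eqxx, nE, nE', mE).
  by rewrite E.
have sgnh t : P t -> (lower_sgn X (h t).1 * lower_sgn Y (h t).2
                      = - (lower_sgn X t.1 * lower_sgn Y t.2))%R.
  case: t => [[x a] [y b]] /Pt[[xX xY aX aY] [yX yY bX bY] [lt_ax lt_by xbya]].
  move=> [xy ab xb ya] E; rewrite /h /=.
  clear PhK P Pt h sumXY.
  have sgE Z u v : lower_sgn Z (v, u) = ((-1) ^+ between Z u v)%R by [].
  have E' (z : 'I_M) : (z : nat) != x -> (z : nat) != a ->
      (z : nat) != y -> (z : nat) != b ->
    (z \in X) = (z \in Y) by exact: E.
  have neq_ay : (a : nat) != y by rewrite eq_sym.
  have neq_bx : (b : nat) != x by rewrite eq_sym.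
  have neq_xy : (x : nat) != y by [].
  clear neqXY E xy ab xb ya.
  have [lt_yx|lt_xy|e] := ltngtP y x; last by rewrite e eqxx in neq_xy.
    have lt_ba : b < a by clear -xbya lt_yx; lia.
    rewrite /= !sgE.
    (* Here b is the smallest and x the largest number, so a and y are the two middle ones, in
       either order; they serve as u and v in [between_swap]. *)
    have [lt_ay|lt_ya|e] := ltngtP a y; last by rewrite e eqxx in neq_ay.
      rewrite (between_swap (X := X) lt_ba lt_ay lt_yx aY yX) ?opprK // => z z_in.
      by apply: E'; clear -z_in lt_yx lt_by lt_ba lt_ay; lia.
    rewrite (between_swap (Y := Y) lt_by lt_ya lt_ax yY aX) // => z z_in.
    by apply: E'; clear -z_in lt_yx lt_by lt_ba lt_ya lt_ax; lia.
  have lt_ab : a < b by clear -xbya lt_xy; lia.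
  rewrite /= !sgE mulrC [in RHS]mulrC.
  have [lt_bx|lt_xb|e] := ltngtP b x; last by rewrite e eqxx in neq_bx.
    rewrite (between_swap (X := Y) lt_ab lt_bx lt_xy bX xY) ?opprK // => z z_in.
    by apply/esym/E'; clear -z_in lt_ax lt_by lt_xy lt_ab lt_bx; lia.
  rewrite (between_swap (X := Y) lt_ax lt_xb lt_by xX bY) // => z z_in.
  by apply/esym/E'; clear -z_in lt_ax lt_by lt_xy lt_ab lt_xb; lia.
(* Reindexing by [h] shows that the sum equals its own opposite, hence vanishes in [rat]. *)
set S := bigop _ _ _; apply/eqP; rewrite -eqNr /S; apply/eqP.
rewrite [RHS](reindex_onto h h) => [|t /PhK[]//].
rewrite -sumrN; apply: eq_big => [t|t /sgnh //].
apply/idP/idP => [Pt'|/andP[/PhK[+ _] /eqP e]]; last by rewrite e.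
by have [Ph ->] := PhK t Pt'; rewrite eqxx andbT; exact: Ph.
Qed.

End Lowering.

(** * Sums over common removals *)

Lemma card_ord_gt N k : \sum_(i < N) (k < i) = N - k.+1.
Proof.
by elim: N => [|N IHN]; rewrite ?big_ord0 // big_ord_recr /= IHN; lia.
Qed.

Lemma card_ord_lt N k : k <= N -> \sum_(i < N) (i < k) = k.
Proof.
have -> : \sum_(i < N) (i < k) = minn N k; last by lia.
by elim: N => [|N IHN]; rewrite ?big_ord0 ?min0n // big_ord_recr /= IHN; lia.
Qed.

Lemma big_beta_set N M f (G : nat -> nat) :
    (forall k, f k.+1 <= f k) -> f 0 + N <= M ->
  \sum_(x in beta_set N M f) G x = \sum_(k < N) G (beta N f k).
Proof.
move=> f_dec f_M; have lt_M (k : 'I_N) : beta N f k < M by apply: beta_ltM.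
pose h k := Ordinal (lt_M k).
have h_inj : injective h.
  move=> k l /(congr1 val) /= e; apply: val_inj => /=.
  have := @beta_lt N f k l f_dec; have := @beta_lt N f l k f_dec.
  by rewrite e ltnn; have := ltn_ord k; have := ltn_ord l; lia.
rewrite (eq_bigl (mem [set h k | k : 'I_N])) => [|x].
  by rewrite (big_imset _ (in2W h_inj)) /=; apply: eq_bigl => k; rewrite inE.
apply/in_beta_set/imsetP => [[k lt_k xk]|[k _ ->]]; last by exists k.
by exists (Ordinal lt_k) => //; apply: val_inj.
Qed.

(** An element x of X can be lowered to x minus the number of elements of X below it many places.
    For the beta-number of row k those elements come from the N - k - 1 later rows, which leaves f
    k. *)
Lemma card_lowering N M f : (forall k, f k.+1 <= f k) -> f 0 + N <= M ->
  #|[set p | lowering (beta_set N M f) p]| = \sum_(k < N) f k.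
Proof.
move=> f_dec f_M; set X := beta_set N M f.
have -> : #|[set p | lowering X p]| =
    \sum_(x in X) (x - \sum_(z in X) (z < x)).
  rewrite -sum1_card (eq_bigl (fun p => (p.1 \in X) && ((p.2 \notin X) && (p.2 < p.1)))).
    rewrite -(pair_big_dep (mem X) (fun x a => (a \notin X) && (a < x)) (fun _ _ => 1)) /=.
    apply: eq_bigr => x _.
    have xE := card_ord_lt (ltnW (ltn_ord x)); rewrite (bigID (mem X)) /= in xE.
    rewrite -[X in _ = X - _]xE addKn big_mkcondr /=.
    by apply: eq_bigr => a _; case: ltnP.
  by move=> p; rewrite inE.
rewrite (@big_beta_set _ _ _ (fun x => x - \sum_(z in X) (z < x))) //.
apply: eq_bigr => k _;
rewrite (@big_beta_set _ _ _ (fun z => nat_of_bool (z < beta N f k))) //.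
rewrite (eq_bigr (fun l : 'I_N => nat_of_bool (k < l))) ?card_ord_gt ?addnK // => l _.
  congr nat_of_bool; have f_lt i j := @beta_lt N f i j f_dec.
  have lt_k := ltn_ord k; have lt_l := ltn_ord l.
  have := f_lt k l; have := f_lt l k.
  by case: (ltngtP (k : nat) l) => [||->]; rewrite ?ltnn //; lia.
Qed.

Lemma sumn_nth (s : seq nat) N : size s <= N -> \sum_(k < N) nth 0 s k = sumn s.
Proof.
elim: s N => [|x s IHs] [|N] //= lt_s; rewrite ?big_ord0 //.
  by rewrite big1 // => k _; rewrite nth_default.
by rewrite big_ord_recl /= IHs.
Qed.

Section IntPart.

Variable n : nat.

Lemma size_intpart m (lam : intpart m) : size lam <= m.
Proof.
by have /andP[/leq_size_sumn + /eqP sE] := valP (comp_of_part lam); rewrite sE.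
Qed.

Lemma sumn_intpart m (lam : intpart m) : sumn lam = m.
Proof. by have /andP[_ /eqP] := valP (comp_of_part lam). Qed.

Lemma nth_intpart_le m (lam : intpart m) k : nth 0 lam k <= m.
Proof.
have [lt_k|le_k] := ltnP k (size lam); last by rewrite nth_default.
by rewrite -[X in _ <= X](sumn_intpart lam) mem_leq_sumn ?mem_nth.
Qed.

Lemma nth_intpart_gt0 m (lam : intpart m) k : (0 < nth 0 lam k) = (k < size lam).
Proof.
have [lt_k|le_k] := ltnP k (size lam); last by rewrite nth_default.
have /andP[lam0 _] := valP (comp_of_part lam).
by rewrite lt0n; apply/negP => /eqP k0; have := mem_nth 0 lt_k; rewrite k0; apply/negP.
Qed.

Lemma eq_nth_intpart m m' (lam : intpart m) (mu : intpart m') :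
  (forall k, nth 0 lam k = nth 0 mu k) -> lam = mu :> seq nat.
Proof.
move=> E; have sE k : (k < size lam) = (k < size mu) by rewrite -!nth_intpart_gt0 E.
apply: (@eq_from_nth _ 0) => //.
by have := sE (size lam); have := sE (size mu); rewrite !ltnn; lia.
Qed.

Lemma intpart_exists (g : nat -> nat) N : (forall k, g k.+1 <= g k) ->
  (forall k, N <= k -> g k = 0) -> exists m (gam : intpart m), nth 0 gam =1 g.
Proof.
move=> g_dec gN; have exL : exists L, g L == 0 by exists N; rewrite gN.
case: (ex_minnP exL) => L /eqP gL0 L_min; pose s := mkseq g L.
have s0 : (0 \notin s) && (sumn s == sumn s).
  rewrite eqxx andbT; apply/mapP => -[k]; rewrite mem_iota => /= lt_k g0.
  by have := L_min k; rewrite -g0 eqxx; lia.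
have s_dec : sorted geq s.
  apply/(sortedP 0) => k; rewrite size_mkseq => lt_k.
  by rewrite !nth_mkseq //; [apply: g_dec|lia].
exists (sumn s); exists (@IntPart _ (Composition s0) s_dec) => k /=.
have [lt_k|le_k] := ltnP k L; first by rewrite nth_mkseq.
rewrite nth_default ?size_mkseq //.
by have := dec_leq g_dec le_k; lia.
Qed.

Local Notation sig := {k : 'I_n.+1 & intpart k}.

Lemma eq_sig_intpart (g g' : sig) :
  tagged g = tagged g' :> seq nat -> g = g'.
Proof.
case: g g' => k gam [k' gam'] /= E.
have kk' : k = k' by apply: val_inj; rewrite /= -(sumn_intpart gam) -(sumn_intpart gam') E.
by subst k'; congr existT; do 2 apply: val_inj.
Qed.

(** The same n rows are used for all partitions of m <= n, so that sets of partitions of different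
    sizes are comparable; their beta-numbers are below n + n. *)
Definition beta_intpart m (lam : intpart m) := beta_set n (n + n) (nth 0 lam).

Lemma beta_intpart_inj m m' (lam : intpart m) (mu : intpart m') :
    m <= n -> m' <= n -> beta_intpart lam = beta_intpart mu ->
  lam = mu :> seq nat.
Proof.
move=> le_m le_m' E; apply/eq_nth_intpart => k.
have [lt_k|le_k] := ltnP k n; last first.
  by rewrite !nth_default //; apply: leq_trans (size_intpart _) (leq_trans _ le_k).
apply: (@beta_set_inj n (n + n)) E lt_k; try exact: nth_intpart_dec.
  by rewrite leq_add2r (leq_trans (nth_intpart_le _ _)).
by rewrite leq_add2r (leq_trans (nth_intpart_le _ _)).
Qed.

Lemma beta_sig_inj (g g' : sig) :
  beta_intpart (tagged g) = beta_intpart (tagged g') -> g = g'.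
Proof.
by move=> E; apply/eq_sig_intpart/beta_intpart_inj => //; rewrite -ltnS.
Qed.

Lemma removal_lowering (lam : intpart n) (g : sig) :
    removal_of_rim_hook lam (tagged g) -> exists p,
  [/\ lowering (beta_intpart lam) p,
      beta_intpart (tagged g) = lower (beta_intpart lam) p &
      lower_sgn (beta_intpart lam) p = sgn (dg lam `\` dg (tagged g))].
Proof.
case/removal_of_rim_hookP => i [j fg]; rewrite (sgn_rim_shape fg).
have lam_dec := nth_intpart_dec lam; have g_dec := nth_intpart_dec (tagged g).
have lam_n : nth 0 lam 0 + n <= n + n by rewrite leq_add2r nth_intpart_le.
have [le_ij _ _ gj] := fg.
have lt_j : j < n.
  apply: leq_trans (size_intpart lam); rewrite -nth_intpart_gt0; lia.
have lt_i : i < n by lia.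
have lt_x : beta n (nth 0 lam) i < n + n by apply: beta_ltM.
have lt_a : beta n (nth 0 (tagged g)) j < n + n.
  apply: ltn_trans (beta_ltM lam_dec lam_n lt_j); rewrite /beta; lia.
exists (Ordinal lt_x, Ordinal lt_a).
have lowerP := rim_shape_lower lam_dec lam_n (x := Ordinal lt_x) (a := Ordinal lt_a).
by have [] := lowerP _ _ _ g_dec fg lt_j.
Qed.

Lemma lowering_removal (lam : intpart n) p : lowering (beta_intpart lam) p ->
  exists2 g : sig, removal_of_rim_hook lam (tagged g) &
    beta_intpart (tagged g) = lower (beta_intpart lam) p.
Proof.
case: p => x a pP; have lam_dec := nth_intpart_dec lam.
have lam_n : nth 0 lam 0 + n <= n + n by rewrite leq_add2r nth_intpart_le.
have lam0 k : n <= k -> nth 0 lam k = 0.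
  by move=> le_k; rewrite nth_default // (leq_trans (size_intpart _)).
have [g [i [j [g_dec g0 fg lt_j [xE aE]]]]] := lower_rim_shape lam_dec lam0 pP.
have [m [gam gamE]] := intpart_exists g_dec g0.
have {}fg : rim_shape (nth 0 lam) (nth 0 gam) i j.
  by case: fg => le_ij gE gS gj; split=> // [k|k|]; rewrite gamE; auto.
have rem : removal_of_rim_hook lam gam by apply/removal_of_rim_hookP; exists i, j.
have lt_m : m < n.+1.
  rewrite ltnS -(sumn_intpart gam) -(sumn_intpart lam) -!card_dg.
  by have /and3P[/fsubset_leq_card] := rem.
exists (Tagged (fun k : 'I_n.+1 => intpart k) (gam : intpart (Ordinal lt_m))) => //=.
have aE' : val a = beta n (nth 0 gam) j by rewrite aE /beta gamE.
by have [] := rim_shape_lower lam_dec lam_n (nth_intpart_dec gam) fg lt_j xE aE'.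
Qed.

(** The sum has at most one term. Writing the signed indicator of a removal as a sum lets the sum
    over common removals be expanded into pairs of lowerings. *)
Lemma sum_lowering_removal (lam : intpart n) (g : sig) :
  (\sum_(p | lowering (beta_intpart lam) p &&
             (beta_intpart (tagged g) == lower (beta_intpart lam) p))
     lower_sgn (beta_intpart lam) p
   = if removal_of_rim_hook lam (tagged g)
     then sgn (dg lam `\` dg (tagged g)) else 0)%R.
Proof.
case: ifP => [/removal_lowering[p [pX gE <-]]|nrem].
  rewrite (big_pred1 p) // => q; apply/andP/eqP => [[qX]|->]; last by rewrite gE.
  by rewrite gE => /eqP/(lower_inj pX qX).
rewrite big1 // => p /andP[/lowering_removal[g' rem <-] /eqP/beta_sig_inj gg'].
by rewrite gg' rem in nrem.
Qed.

Lemma sum_common_removals (lam mu : intpart n) :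
  (\sum_(g in common_removals lam mu)
     sgn (dg lam `\` dg (tagged g)) * sgn (dg mu `\` dg (tagged g))
   = n%:R * (lam == mu)%:R)%R.
Proof.
set X := beta_intpart lam; set Y := beta_intpart mu.
have le_n (la : intpart n) : nth 0 la 0 + n <= n + n.
  by rewrite leq_add2r nth_intpart_le.
have -> : (\sum_(g in common_removals lam mu)
     sgn (dg lam `\` dg (tagged g)) * sgn (dg mu `\` dg (tagged g)) =
   \sum_(p | lowering X p) \sum_(q | lowering Y q && (lower X p == lower Y q))
      lower_sgn X p * lower_sgn Y q)%R.
  transitivity (\sum_(g : sig)
    (\sum_(p | lowering X p && (beta_intpart (tagged g) == lower X p)) lower_sgn X p) *
    (\sum_(q | lowering Y q && (beta_intpart (tagged g) == lower Y q)) lower_sgn Y q))%R.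
    rewrite big_mkcond; apply: eq_bigr => g _; rewrite !sum_lowering_removal inE.
    by do 2!case: removal_of_rim_hook; rewrite ?mulr0 ?mul0r.
  under eq_bigr => g _ do rewrite big_distrlr /=.
  rewrite (exchange_big_dep (lowering X)) => [|g p _ /andP[] //] /=.
  apply: eq_bigr => p pX; rewrite (exchange_big_dep (lowering Y)) => [|g q _ /andP[] //] /=.
  rewrite [RHS]big_mkcondr; apply: eq_bigr => q qY.
  (* The lowering p comes from exactly one partition [g0], so the inner sum over g collapses. *)
  have [g0 rem gE] := lowering_removal pX.
  rewrite (eq_bigl (fun g => (g == g0) && (lower X p == lower Y q))) => [|g].
    case: ifP => E; last by rewrite big1 // => g; rewrite andbF.
    by rewrite (big_pred1 g0) // => g; rewrite andbT.
  rewrite pX qY /= -gE; case: (eqVneq g g0) => [->|ne]; first by rewrite eqxx.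
  suff -> : (beta_intpart (tagged g) == beta_intpart (tagged g0)) = false by [].
  by apply/negP => /eqP/beta_sig_inj/eqP; apply/negP.
(* The sum of the beta-numbers depends on n only, as [lowering_offdiag] requires. *)
have sumX (la : intpart n) : \sum_(z in beta_intpart la) z = n + \sum_(k < n) (n - k.+1).
  rewrite (@big_beta_set _ _ _ id) ?le_n //; last exact: nth_intpart_dec.
  by rewrite big_split /= sumn_nth ?sumn_intpart ?size_intpart.
have [e|neq] := eqVneq lam mu.
  rewrite /Y -e lowering_diag card_lowering ?le_n //; last exact: nth_intpart_dec.
  by rewrite sumn_nth ?size_intpart // sumn_intpart mulr1.
rewrite lowering_offdiag ?mulr0 ?sumX //.
apply: contra neq => /eqP E; apply/eqP; do 2 apply: val_inj.
exact: beta_intpart_inj E.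
Qed.

End IntPart.

(** * Removing the last rim-hook of a filling *)

(* Boxes outside the diagram get the junk label [size b], which no box of the *)
(* diagram carries.                                                           *)
Definition label (a b : seq nat) (S : filling a b) (x : box) : nat :=
  if insub x is Some c then S c else size b.

Definition cells (a b : seq nat) (S : filling a b) (P : pred nat) : {fset box} :=
  [fset x in dg a | P (label S x)].

Lemma label_val a b (S : filling a b) (c : dg a) : label S (val c) = S c.
Proof. by rewrite /label valK. Qed.

Lemma in_cells a b (S : filling a b) P x :
  (x \in cells S P) = (x \in dg a) && P (label S x).
Proof. by rewrite !inE. Qed.

Lemma label_lt a b (S : filling a b) x : (label S x < size b) = (x \in dg a).
Proof.
rewrite /label; case: insubP => [c xa <-|/negPf->]; last exact: ltnn.
by rewrite ltn_ord (valP c).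
Qed.

Lemma label_le a b (S : filling a b) x : label S x <= size b.
Proof.
by rewrite /label; case: insubP => // c _ _; apply/ltnW/ltn_ord.
Qed.

Lemma label_inj a b (S T : filling a b) :
  (forall x, x \in dg a -> label S x = label T x) -> S = T.
Proof.
move=> ST; apply/ffunP => c; apply: val_inj; have := ST (val c) (valP c).
by rewrite !label_val.
Qed.

Lemma cells_withE a b (S : filling a b) (P : pred nat) :
  cells_with S (fun k => P k) = cells S P.
Proof.
apply/fsetP => x; rewrite in_fset_val in_cells /label.
by case: insubP => [c -> _|/negPf-> //]; rewrite !inE.
Qed.

Lemma filling_sgnE a b (S : filling a b) :
  filling_sgn S = (\prod_(k < size b) sgn (cells S (pred1 (k : nat))))%R.
Proof. by apply: eq_bigr => k _; congr sgn; apply: (cells_withE S (pred1 (k : nat))). Qed.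

Definition RHT_at (a b : seq nat) (S : filling a b) (k : nat) :=
  [&& is_rim_hook (cells S (pred1 k)), #|` cells S (pred1 k)| == nth 0 b k
    & is_partition_diagram (cells S (fun l => l <= k))].

Lemma in_RHT a b (S : filling a b) :
  reflect (forall k, k < size b -> RHT_at S k) (S \in RHT a b).
Proof.
rewrite inE; apply: (iffP forallP) => [SP k lt_k|SP k].
  have := SP (Ordinal lt_k).
  by rewrite (cells_withE S (pred1 k)) (cells_withE S (fun l => l <= k)).
have := SP k (ltn_ord k).
by rewrite /RHT_at -(cells_withE S (pred1 (k : nat))) -(cells_withE S (fun l => l <= k)).
Qed.

Lemma is_partition_diagramP m X : #|` X| = m ->
  reflect (exists gam : intpart m, X = dg gam) (is_partition_diagram X).
Proof.
move=> Xm; subst m; apply: (iffP existsP) => [] [gam].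
  by move/eqP; exists gam.
by move=> XE; exists gam; apply/eqP.
Qed.

Lemma dg_inj m : injective (fun gam : intpart m => dg gam).
Proof.
move=> gam gam' /fsetP E; do 2 apply: val_inj; apply: eq_nth_intpart => k.
apply/eqP; rewrite eqn_leq.
by apply/andP; split; rewrite leqNgt; apply/negP => lt;
  [have := E (k, nth 0 gam' k)|have := E (k, nth 0 gam k)];
  rewrite !in_dg lt ltnn.
Qed.

Section AddRimHook.

Variables (n m : nat) (lam : intpart n) (b : seq nat) (lt_mn : m < n).

Let b' := rcons b (n - m).

Lemma label_lt_rcons a (S : filling a b) x : label S x < size b'.
Proof. by rewrite size_rcons ltnS label_le. Qed.

(** The junk label [size b] of boxes outside the smaller diagram is precisely the label of the new
    last rim-hook, so the labels need no change. *)
Definition add_rim_hook (a : seq nat) (S : filling a b) : filling lam b' :=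
  [ffun c => Ordinal (label_lt_rcons S (val c))].

Lemma label_add a (S : filling a b) x : x \in dg lam ->
  label (add_rim_hook S) x = label S x.
Proof.
by move=> x_lam; rewrite {1}/label insubT /= ffunE.
Qed.

Section Fixed.

Variables (gam : intpart m) (rem : removal_of_rim_hook lam gam).

Let sub : {subset dg gam <= dg lam}.
Proof. by have /and3P[/fsubsetP] := rem. Qed.

Lemma add_rim_hook_inj : injective (@add_rim_hook gam).
Proof.
move=> S T ST; apply: label_inj => x x_gam.
by have := label_add S (sub x_gam); rewrite ST label_add ?sub.
Qed.

Lemma cells_add (S : filling gam b) (P : pred nat) :
  (forall k, P k -> k < size b) -> cells (add_rim_hook S) P = cells S P.
Proof.
move=> Pb; apply/fsetP => x; rewrite !in_cells.
apply/andP/andP => [] [x_in]; first by rewrite label_add // => Px; rewrite -(label_lt S) Pb.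
by move=> Px; rewrite label_add sub.
Qed.

Lemma cells_add_last (S : filling gam b) :
  cells (add_rim_hook S) (pred1 (size b)) = dg lam `\` dg gam.
Proof.
apply/fsetP => x; rewrite in_cells in_fsetD andbC.
have [x_lam|//] := boolP (x \in dg lam); rewrite ?andbF // !andbT label_add //=.
by rewrite -(label_lt S) -leqNgt eqn_leq label_le.
Qed.

Lemma card_skew : #|` dg lam `\` dg gam| = n - m.
Proof.
rewrite cardfsDS; last by apply/fsubsetP.
by rewrite !card_dg !sumn_intpart.
Qed.

Lemma is_partition_diagram_dg k (mu : intpart k) : is_partition_diagram (dg mu).
Proof.
have mk : #|` dg mu| = k by rewrite card_dg sumn_intpart.
by apply/(is_partition_diagramP mk); exists mu.
Qed.

(** The conditions at the old labels involve old cells only; those at the new label hold because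
    [lam] is a partition and [rem] makes the skew part a rim-hook. *)
Lemma add_rim_hook_RHT (S : filling gam b) :
  (add_rim_hook S \in RHT lam b') = (S \in RHT gam b).
Proof.
have E k : k < size b -> RHT_at (add_rim_hook S) k = RHT_at S k.
  move=> lt_k; rewrite /RHT_at nth_rcons lt_k !cells_add // => l /=.
    by move=> /leq_ltn_trans; apply.
  by move/eqP->.
apply/in_RHT/in_RHT => [SP k lt_k|SP k]; first by rewrite -E // SP // size_rcons ltnW.
rewrite size_rcons ltnS leq_eqVlt => /predU1P[->|lt_k]; last by rewrite E // SP.
apply/and3P; split; rewrite ?cells_add_last ?nth_rcons ?ltnn ?eqxx ?card_skew //.
  by have /and3P[] := rem.
rewrite (_ : cells _ _ = dg lam) ?is_partition_diagram_dg //.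
apply/fsetP => x; rewrite in_cells; case: (boolP (x \in dg lam)) => //= x_lam.
by rewrite label_add // label_le.
Qed.

Lemma filling_sgn_add (S : filling gam b) :
  filling_sgn (add_rim_hook S) = (filling_sgn S * sgn (dg lam `\` dg gam))%R.
Proof.
rewrite !filling_sgnE -(big_mkord xpredT (fun k => sgn (cells (add_rim_hook S) (pred1 k)))).
rewrite {1}size_rcons big_mkord big_ord_recr /= cells_add_last; congr (_ * _)%R.
by apply: eq_bigr => k _; rewrite cells_add // => l /eqP->.
Qed.

End Fixed.

Lemma RHT_add_rim_hook (gam : intpart m) (S : filling lam b') :
    S \in RHT lam b' -> cells S (fun l => l < size b) = dg gam ->
  removal_of_rim_hook lam gam /\ exists T : filling gam b, S = add_rim_hook T.
Proof.
move=> /in_RHT SP Sgam.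
have gamP x : (x \in dg gam) = (x \in dg lam) && (label S x < size b).
  by rewrite -Sgam in_cells.
have sub : dg gam `<=` dg lam.
  by apply/fsubsetP => x; rewrite gamP => /andP[].
split.
  have := SP (size b); rewrite size_rcons ltnSn => /(_ isT) /and3P[hook + _].
  rewrite nth_rcons ltnn eqxx => /eqP sz.
  have E : cells S (pred1 (size b)) = dg lam `\` dg gam.
    apply/fsetP => x; rewrite in_cells in_fsetD gamP.
    case: (boolP (x \in dg lam)) => [x_lam|]; rewrite ?andbF //= andbT.
    by have := label_lt S x; rewrite x_lam size_rcons ltnS eqn_leq -leqNgt => ->.
  rewrite E in hook sz; apply/and3P; split => //.
  by rewrite -cardfs_gt0 sz subn_gt0.
have lt_S (c : dg gam) : label S (val c) < size b.
  by have := valP c; rewrite gamP => /andP[].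
exists [ffun c => Ordinal (lt_S c)]; apply: label_inj => x x_lam.
rewrite label_add // {2}/label; case: insubP => [c _ <-|]; first by rewrite ffunE.
rewrite gamP x_lam /= -leqNgt => le_b; apply/eqP; rewrite eqn_leq le_b andbT.
by rewrite -ltnS -(size_rcons b (n - m)) label_lt.
Qed.

Lemma RHT_partition (S : filling lam b') : S \in RHT lam b' ->
  exists gam : intpart m, cells S (fun l => l < size b) = dg gam.
Proof.
move=> /in_RHT SP; set D := cells _ _.
have := SP (size b); rewrite size_rcons ltnSn => /(_ isT) /and3P[_ + _].
rewrite nth_rcons ltnn eqxx => /eqP sz.
have Dm : #|` D| = m.
  have -> : D = dg lam `\` cells S (pred1 (size b)).
    apply/fsetP => x; rewrite in_fsetD !in_cells /=.
    case: (boolP (x \in dg lam)) => [x_lam|]; rewrite ?andbF //= andbT.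
    by have := label_lt S x; rewrite x_lam size_rcons ltnS ltn_neqAle => ->; rewrite andbT.
  rewrite cardfsDS; first by rewrite sz card_dg sumn_intpart subKn // ltnW.
  by apply/fsubsetP => x; rewrite in_cells => /andP[].
apply/(is_partition_diagramP Dm).
(* If b is empty there is no earlier label to provide a partition diagram, but then the remaining
   cells are empty. *)
have [b0|b_gt0] := posnP (size b).
  have D0 : D = fset0 by apply/fsetP => x; rewrite in_cells b0 ltn0 andbF.
  have nilP : (0 \notin [::]) && (sumn [::] == 0) by [].
  have nilS : sorted geq (Composition nilP) by [].
  rewrite D0; apply/(is_partition_diagramP (@cardfs0 _)); exists (IntPart nilS).
  by apply/fsetP => -[i j]; rewrite in_dg nth_nil.
have := SP (size b).-1; rewrite size_rcons => /(_ _)/and3P[|_ _]; first lia.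
rewrite (_ : cells _ _ = D) //; apply/fsetP => x; rewrite !in_cells.
by rewrite -ltnS prednK.
Qed.

Lemma sum_RHT_rcons :
  (\sum_(S in RHT lam b') filling_sgn S =
   \sum_(gam : intpart m | removal_of_rim_hook lam gam)
     sgn (dg lam `\` dg gam) * \sum_(S in RHT gam b) filling_sgn S)%R.
Proof.
(* Each filling is tagged by the unique partition that its cells form once the last hook is
   deleted. *)
transitivity (\sum_(S in RHT lam b')
    \sum_(gam : intpart m | cells S (fun l => (l < size b)%N) == dg gam) filling_sgn S)%R.
  apply: eq_bigr => S /RHT_partition[gam gamE]; rewrite (big_pred1 gam) // => gam'.
  by rewrite gamE (inj_eq (@dg_inj m)) eq_sym.
rewrite (exchange_big_dep (removal_of_rim_hook lam)) /=; last first.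
  by move=> S gam /RHT_add_rim_hook/[swap] /eqP Sgam /(_ _ Sgam)[].
apply: eq_bigr => gam rem; rewrite mulr_sumr.
rewrite (eq_bigl (mem [set add_rim_hook S | S in RHT gam b])) => [|S].
  rewrite big_imset /= => [|S T _ _ /(add_rim_hook_inj rem)] //.
  by apply: eq_bigr => S _; rewrite filling_sgn_add // mulrC.
apply/andP/imsetP => [[SP /eqP Sgam]|[T TP ->]].
  have [_ [T ST]] := RHT_add_rim_hook SP Sgam.
  by exists T => //; rewrite -add_rim_hook_RHT // -ST.
rewrite add_rim_hook_RHT //; split=> //; apply/eqP.
rewrite cells_add //; apply/fsetP => x; rewrite in_cells label_lt.
by rewrite andbb.
Qed.

End AddRimHook.

(** * Sums over compositions *)

Lemma Zcomp_rcons b x : Zcomp (rcons b x) = Zcomp b * (sumn b + x).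
Proof.
rewrite /Zcomp size_rcons big_ord_recr /= -(size_rcons b x) take_size sumn_rcons.
by congr (_ * _); apply: eq_bigr => k _; rewrite -cats1 takel_cat.
Qed.

Lemma sumn_composition n (b : composition n) : sumn b = n.
Proof. by have /andP[_ /eqP] := valP b. Qed.

Local Open Scope ring_scope.

(** A composition of n > 0 is determined by what precedes its last part, a composition of some m <
    n; the last part is then n - m. *)
Lemma sum_composition n (F : seq nat -> rat) : (0 < n)%N ->
  \sum_(b : composition n) F b =
  \sum_(m < n) \sum_(b : composition m) F (rcons b (n - m)%N).
Proof.
move=> n_gt0; pose comp_of := fun m : 'I_n => composition m.
rewrite (sig_big_dep (J := comp_of) xpredT (fun _ => xpredT)
  (fun m b => F (rcons b (n - m)%N))) /=.
have hP (p : {m : 'I_n & composition m}) :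
    (0%N \notin rcons (tagged p) (n - tag p)%N) &&
    (sumn (rcons (tagged p) (n - tag p)%N) == n).
  case: p => m b /=; rewrite mem_rcons inE sumn_rcons sumn_composition.
  rewrite subnKC ?(ltnW (ltn_ord m)) // eqxx andbT negb_or.
  have /andP[-> _] := valP b; rewrite andbT eq_sym subn_eq0 -ltnNge.
  exact: ltn_ord.
pose h p := Composition (hP p).
have h_inj : injective h.
  case=> m b [m' b'] /(congr1 (@parts n)) /= /rcons_inj[bb' mm'].
  have {}mm' : m = m' by apply: val_inj => /=; have := ltn_ord m; have := ltn_ord m'; lia.
  by subst m'; congr existT; apply: val_inj.
rewrite (eq_bigl (mem [set h p | p : {m : 'I_n & composition m}])) => [|b].
  rewrite big_imset /= => [|p q _ _ /h_inj //].
  by apply: eq_big => // p; rewrite inE.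
apply/esym/imsetP; have /andP[] := valP b; case/lastP E : (val b) => [|s x].
  by move=> _ /= /eqP n0; rewrite -n0 in n_gt0.
rewrite mem_rcons inE negb_or sumn_rcons => /andP[x0 s0] /eqP sn.
have lt_s : (sumn s < n)%N by lia.
have sP : (0%N \notin s) && (sumn s == sumn s) by rewrite s0 eqxx.
exists (Tagged comp_of (Composition sP : comp_of (Ordinal lt_s))) => //.
by apply: val_inj; rewrite /= E; congr rcons; lia.
Qed.

Lemma sum_RHT_nil (lam : intpart 0) : \sum_(S in RHT lam [::]) filling_sgn S = 1.
Proof.
have lam0 : dg lam = fset0.
  by apply/eqP; rewrite -cardfs_eq0 card_dg sumn_intpart.
rewrite (eq_bigr (fun _ => 1)) => [|S _]; last by rewrite /filling_sgn big_ord0.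
rewrite sumr_const (_ : RHT lam [::] = setT); last first.
  by apply/setP => S; rewrite !inE; apply/forallP => -[].
by rewrite cardsT card_ffun card_ord -cardfE card_dg sumn_intpart.
Qed.

Lemma removal_lt n m (lam : intpart n) (gam : intpart m) :
  removal_of_rim_hook lam gam -> (m < n)%N.
Proof.
case/and3P=> /[dup] sub /cardfsDS + + _; rewrite -cardfs_gt0 => ->.
by rewrite !card_dg !sumn_intpart subn_gt0.
Qed.

Lemma sum_common_removals_split n (lam mu : intpart n)
    (F : forall m, intpart m -> rat) :
  \sum_(g in common_removals lam mu) F _ (tagged g) =
  \sum_(m < n) \sum_(gam : intpart m |
      removal_of_rim_hook lam gam && removal_of_rim_hook mu gam) F _ gam.
Proof.
rewrite (eq_bigl (fun g : {k : 'I_n.+1 & intpart k} =>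
  xpredT (tag g) && (removal_of_rim_hook lam (tagged g) &&
                     removal_of_rim_hook mu (tagged g)))); last first.
  by move=> g; rewrite inE.
rewrite -(sig_big_dep (J := fun k : 'I_n.+1 => intpart k) xpredT
  (fun k gam => removal_of_rim_hook lam gam && removal_of_rim_hook mu gam)
  (fun k gam => F _ gam)) /= big_ord_recr /= [X in _ + X]big1 ?addr0 //.
by move=> gam /andP[/removal_lt]; rewrite ltnn.
Qed.

Lemma sum_RHT_orthogonal n (lam mu : intpart n) :
  \sum_(b : composition n) (Zcomp b)%:R^-1 *
     (\sum_(S in RHT lam b) filling_sgn S) *
     (\sum_(S in RHT mu b) filling_sgn S) = (lam == mu)%:R.
Proof.
elim/ltn_ind: n lam mu => -[|n] IHn lam mu.
  have nil0 (b : composition 0) : b = [::] :> seq nat.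
    apply/nilP; rewrite /nilp -leqn0 -[X in (_ <= X)%N](sumn_composition b).
    by rewrite leq_size_sumn //; have /andP[] := valP b.
  have -> : lam = mu.
    by do 2 apply: val_inj; exact: etrans (nil0 lam) (esym (nil0 mu)).
  have P0 : (0%N \notin [::]) && (sumn [::] == 0%N) by [].
  rewrite (big_pred1 (Composition P0)) => [|b]; last first.
    by apply/esym/eqP/val_inj; exact: nil0 b.
  by rewrite /= !sum_RHT_nil /Zcomp big_ord0 invr1 !mulr1 eqxx.
rewrite (sum_composition (fun b => (Zcomp b)%:R^-1 *
     (\sum_(S in RHT lam b) filling_sgn S) *
     (\sum_(S in RHT mu b) filling_sgn S))) //.
transitivity (n.+1%:R^-1 * \sum_(g in common_removals lam mu)
   sgn (dg lam `\` dg (tagged g)) * sgn (dg mu `\` dg (tagged g))); last first.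
  by rewrite sum_common_removals mulKf // pnatr_eq0.
rewrite (sum_common_removals_split lam mu
  (fun m gam => sgn (dg lam `\` dg gam) * sgn (dg mu `\` dg gam))) mulr_sumr.
apply: eq_bigr => m _; have lt_m := ltn_ord m.
pose w (gam : intpart m) (b : seq nat) := \sum_(S in RHT gam b) filling_sgn S.
(* The factor n + 1 of [Zcomp] does not depend on m. For fixed [gam] and [gam'] the sum over b is
   the induction hypothesis for m, which keeps only the terms with equal partitions. *)
transitivity (\sum_(b : composition m)
   \sum_(gam | removal_of_rim_hook lam gam) \sum_(gam' | removal_of_rim_hook mu gam')
     n.+1%:R^-1 * (sgn (dg lam `\` dg gam) * sgn (dg mu `\` dg gam')) *
     ((Zcomp b)%:R^-1 * w gam b * w gam' b)).
  apply: eq_bigr => b _; rewrite !sum_RHT_rcons // Zcomp_rcons sumn_composition.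
  rewrite subnKC ?(ltnW lt_m) // natrM invfM -mulrA big_distrlr /= mulr_sumr.
  apply: eq_bigr => gam _; rewrite mulr_sumr; apply: eq_bigr => gam' _.
  rewrite -/(w gam b) -/(w gam' b); ring.
rewrite exchange_big /= mulr_sumr [RHS]big_mkcondr; apply: eq_bigr => gam _.
rewrite exchange_big /=.
under eq_bigr => gam' _ do rewrite -mulr_sumr IHn //.
case: ifP => rem.
  rewrite (bigD1 gam) //= eqxx mulr1 big1 ?addr0 // => gam' /andP[_ /negPf].
  by rewrite eq_sym => ->; rewrite mulr0.
rewrite big1 // => gam' rem'; case: eqP => [e|]; last by rewrite mulr0.
by rewrite -e rem in rem'.
Qed.

Theorem theorem4p4 :
  (forall (n : nat) (lam mu : intpart n), (0 < n)%N ->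
     \sum_(g in common_removals lam mu)
        n%:R^-1 * sgn (dg lam `\` dg (tagged g)) * sgn (dg mu `\` dg (tagged g))
     = (lam == mu)%:R)
  /\ (forall n : nat, A_mx n *m B_mx n = 1%:M).
Proof.
split=> [n lam mu n_gt0|n].
  under eq_bigr => g _ do rewrite -mulrA.
  by rewrite -mulr_sumr sum_common_removals mulKf // pnatr_eq0 -lt0n.
apply/matrixP => i j; rewrite !mxE -(inj_eq enum_val_inj) -sum_RHT_orthogonal.
rewrite (big_enum_val (A := {: composition n})).
apply: eq_bigr => k _; rewrite !mxE /= -mulr_sumr; ring.
Qed.
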